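(* Let $\mathcal{J}=\{j_\ell\}_{\ell\ge0}$, $\mathcal{N}=\{n_\ell\}_{\ell\ge0}$ be parameter sequences such that, for some $\varepsilon>0$, $\lim_{i\to\infty}N_ie^{-J_i^2t}<\infty$ for all $t\in(0,\varepsilon)$. The heat kernel of the associated diamond fractal $F_\infty$ is the function $p_t^{F_\infty}(x,y)$, $(t,x,y)\in(0,\infty)\times F_\infty\times F_\infty$, given by $$p_t^{F_\infty}(x,y)=p_t^{F_{i_*}}\big(\Phi_{i_*}(x),\Phi_{i_*}(y)\big),$$ where $i_*=i_*(x,y)=\max\{i\ge1:\ \Phi_i(x)\text{ and }\Phi_i(y)\text{ belong to } i\text{-cells in the same bundle}\}$, with the convention that $i_*=0$ if the set is empty and that, if the set is infinite (as happens for $x=y$), the right-hand side is understood as $\lim_{i\to\infty}p_t^{F_i}(\Phi_i(x),\Phi_i(y))$.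
   Context: Parameters. $j_\ell,n_\ell$ are integers with $j_0=n_0=1$ and $j_\ell,n_\ell\ge2$ for $\ell\ge1$. Set $J_0=N_0=1$, $J_i=\prod_{\ell=1}^ij_\ell$, $N_i=\prod_{\ell=1}^in_\ell$, $[n_i]=\{1,\dots,n_i\}$, $L_i=\pi/J_i$ for $i\ge1$. Spaces. Let $\vartheta_0=\{0,\pi\}$ and, for $i\ge1$, $\vartheta_i=\{\pi k/J_i: 0<k<2J_i,\ j_i\nmid k\}$; thus $\bigcup_{\ell=0}^i\vartheta_\ell=\{\pi k/J_i:0\le k<2J_i\}$. Let $F_0=\mathbb{R}/2\pi\mathbb{Z}$ (points identified with angles in $[0,2\pi)$), $B_0=\vartheta_0$, $B_1=B_0\cup\vartheta_1$, and inductively for $i\ge1$: $F_i=(F_{i-1}\times[n_i])/\!\sim$ with the quotient topology, where $(x,w)\sim(x',w')$ iff $x=x'$ and ($w=w'$ or $x\in B_i$), and for $i\ge2$, $B_i=B_{i-1}\cup(\vartheta_i\times[n_1]\times\dots\times[n_{i-1}])\subseteq F_{i-1}$ (the set of points of $F_{i-1}$ whose angle lies in $\bigcup_{\ell\le i}\vartheta_\ell$). $[\eta w_1\dots w_i]$ denotes the point of $F_i$ represented by $\eta\in F_0$, $w_\ell\in[n_\ell]$. Let $\phi_i:F_i\to F_{i-1}$ be induced by $(x,w)\mapsto x$. Cells and measures. For $i\ge1$ let $\mathcal{A}_i=\big(\bigcup_{\ell=0}^i\vartheta_\ell\big)\times[n_1]\times\dots\times[n_i]$. For $\alpha=(\eta,w_1,\dots,w_i)\in\mathcal{A}_i$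 let $\varphi_\alpha:[0,L_i]\to F_i$, $\varphi_\alpha(\theta)=[(\eta+\theta)w_1\dots w_i]$, with image the $i$-cell $I_\alpha$. Two $i$-cells $I_\alpha,I_\beta$ are in the same bundle if $\alpha,\beta$ agree in all but possibly their last entry. For $x\in F_i$, $(\theta_x,\alpha_x)\in[0,L_i)\times\mathcal{A}_i$ is a pair with $\varphi_{\alpha_x}(\theta_x)=x$ ($\alpha_x$ smallest in lexicographic order if not unique). $\mu_0$ is Lebesgue measure $d\theta$ on $F_0$, and $\int_{F_i}f\,d\mu_i=\sum_{\alpha\in\mathcal{A}_i}\frac1{N_i}\int_0^{L_i}f(\varphi_\alpha(\theta))\,d\theta$ for $i\ge1$. Limit. The diamond fractal is $F_\infty=\{(x_i)_{i\ge0}: x_i\in F_i,\ \phi_i(x_i)=x_{i-1}\ \forall i\ge1\}$ with the inverse limit topology, $\Phi_i:F_\infty\to F_i$, $\Phi_i((x_k)_k)=x_i$, and $\mu_\infty$ is the Borel measure with $\mu_\infty(\Phi_i^{-1}(A))=\mu_i(A)$ for all $i$ and all $\mu_i$-measurable $A\subseteq F_i$. Write $\Phi_i^*f=f\circ\Phi_i$. Heat kernels on $F_i$. $p_t^{F_0}(\theta_1,\theta_2)=\frac1{2\pi}+\frac1\pi\sum_{k\ge1}e^{-k^2t}\cos(k(\theta_2-\theta_1))$, $p_t^{[0,L_i]_D}(\theta_1,\theta_2)=\frac2{L_i}\sum_{k\ge1}e^{-k^2\pi^2t/L_i^2}\sin(k\pi\theta_1/L_i)\sin(k\pi\theta_2/L_i)$,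 and for $i\ge1$, recursively, $p_t^{F_i}(x,y)=p_t^{F_{i-1}}(\phi_i(x),\phi_i(y))+c_i(x,y)N_{i-1}\,p_t^{[0,L_i]_D}(\theta_x,\theta_y)$, where $c_i(x,y)=0$ if $I_{\alpha_x},I_{\alpha_y}$ are not in the same bundle, $c_i(x,y)=-1$ if they are in the same bundle but $\alpha_x\neq\alpha_y$, and $c_i(x,y)=n_i-1$ if $\alpha_x=\alpha_y$. Let $T_0^{F_i}=\mathrm{id}$ and $T_t^{F_i}f(x)=\int_{F_i}p_t^{F_i}(x,y)f(y)\,\mu_i(dy)$ for $t>0$. Heat kernel on $F_\infty$. The natural diffusion on $F_\infty$ is the limiting Markov process of the diffusions on the $F_i$: its semigroup is the unique strongly continuous Markov (positivity preserving, contractive) semigroup $(T_t)_{t\ge0}$ on $C(F_\infty)$ with $T_t\Phi_i^*f=\Phi_i^*T_t^{F_i}f$ for all $i\ge0$, $t\ge0$, $f\in C(F_i)$. The heat kernel of $F_\infty$ is its integral kernel, i.e. $T_tf(x)=\int_{F_\infty}p_t^{F_\infty}(x,y)f(y)\,\mu_\infty(dy)$ for $f\in C(F_\infty)$, $x\in F_\infty$, $t>0$. *)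

(* Defs.v *)
From HB Require Import structures.
From mathcomp Require Import all_boot all_order all_algebra.
From mathcomp Require Import finmap.
From mathcomp Require Import all_classical all_reals all_analysis.
From mathcomp Require Import measurable_realfun.

Set Implicit Arguments.
Unset Strict Implicit.
Unset Printing Implicit Defensive.

Import Order.TTheory GRing.Theory Num.Theory.
Import numFieldNormedType.Exports.

Local Open Scope classical_set_scope.
Local Open Scope ring_scope.
Local Open Scope quotient_scope.

Record diamond_params := DiamondParams {
  jpar : nat -> nat ;
  npar : nat -> nat ;
  jpar0 : jpar 0 = 1%N ;
  npar0 : npar 0 = 1%N ;
  jpar_ge2 : forall l, (1 <= l)%N -> (2 <= jpar l)%N ;
  npar_ge2 : forall l, (1 <= l)%N -> (2 <= npar l)%N }.

Definition Jprod (P : diamond_params) (i : nat) : nat :=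
  (\prod_(1 <= l < i.+1) jpar P l)%N.

Definition Nprod (P : diamond_params) (i : nat) : nat :=
  (\prod_(1 <= l < i.+1) npar P l)%N.

Lemma npar_gt0 P l : (0 < npar P l)%N.
Proof. by case: l => [|l]; [rewrite npar0|exact: ltnW (npar_ge2 P _)]. Qed.

Lemma jpar_gt0 P l : (0 < jpar P l)%N.
Proof. by case: l => [|l]; [rewrite jpar0|exact: ltnW (jpar_ge2 P _)]. Qed.

Lemma Jprod_gt0 P i : (0 < Jprod P i)%N.
Proof. by rewrite prodn_gt0 // => l; exact: jpar_gt0. Qed.

(* [n_l] is represented by the discrete space 'I_(n_l), i.e. the branch w of
   [n_l] = {1, .., n_l} is numbered w - 1. *)
Definition branch (P : diamond_params) (l : nat) : Type :=
  discrete_topology 'I_(npar P l).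

HB.instance Definition _ P l := Topological.on (branch P l).
HB.instance Definition _ P l :=
  isPointed.Build (branch P l) (Ordinal (npar_gt0 P l)).

Section Glue.
Context (X W : ptopologicalType) (B : set X).

Definition glue_rel : rel (X * W) :=
  fun p q => `[< p.1 = q.1 /\ (p.2 = q.2 \/ B p.1) >].

Lemma glue_rel_refl : reflexive glue_rel.
Proof. by move=> p; apply/asboolP; split; [|left]. Qed.

Lemma glue_rel_sym : symmetric glue_rel.
Proof.
move=> p q; apply/asboolP/asboolP => -[e [->|Bp]]; split => //; try by left.
  by right; rewrite -e.
by right; rewrite -e.
Qed.

Lemma glue_rel_trans : transitive glue_rel.
Proof.
move=> q p r /asboolP[e1 h1] /asboolP[e2 h2]; apply/asboolP; split.
  by rewrite e1.
case: h1 => [->|]; last by right.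
by case: h2 => [->|]; [left|right; rewrite e1].
Qed.

Canonical glue_equiv := EquivRel glue_rel glue_rel_refl glue_rel_sym
  glue_rel_trans.

Definition glue : Type := quotient_topology {eq_quot glue_equiv}.

HB.instance Definition _ := Topological.on glue.
HB.instance Definition _ := Quotient.on glue.
HB.instance Definition _ := isPointed.Build glue (\pi_glue (point, point)).

End Glue.

Section Circle.
Context (R : realType).

Definition circle_rel : rel R :=
  fun x y => `[< exists k : int, x - y = 2 * pi * k%:~R >].

Lemma circle_rel_refl : reflexive circle_rel.
Proof. by move=> x; apply/asboolP; exists 0; rewrite subrr mulr0. Qed.

Lemma circle_rel_sym : symmetric circle_rel.
Proof.
move=> x y; apply/asboolP/asboolP => -[k e]; exists (- k);
  by rewrite rmorphN /= mulrN -e opprB.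
Qed.

Lemma circle_rel_trans : transitive circle_rel.
Proof.
move=> y x z /asboolP[k e] /asboolP[l f]; apply/asboolP; exists (k + l).
by rewrite rmorphD /= mulrDr -e -f addrA subrK.
Qed.

Canonical circle_equiv := EquivRel circle_rel circle_rel_refl circle_rel_sym
  circle_rel_trans.

Definition circle : Type := quotient_topology {eq_quot circle_equiv}.

HB.instance Definition _ := Topological.on circle.
HB.instance Definition _ := Pointed.on circle.
HB.instance Definition _ := Quotient.on circle.

Definition circle_angle (x : circle) : R :=
  get [set t : R | 0 <= t < 2 * pi /\ \pi_circle t = x].

End Circle.

Definition borel (X : ptopologicalType) : Type :=
  g_sigma_algebraType (@open X).

HB.instance Definition _ (X : ptopologicalType) := Measurable.on (borel X).

Section Diamond.
Context (R : realType) (P : diamond_params).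

Local Notation J := (Jprod P).
Local Notation N := (Nprod P).

Definition Lgrid (i : nat) : R := pi / (J i)%:R.

Definition vartheta (i : nat) : set R :=
  if i == 0%N then [set 0; pi]
  else [set pi * k%:R / (J i)%:R | k in
          [set k : nat | (0 < k < 2 * J i)%N /\ ~~ (jpar P i %| k)%N]].

Record level := Level {
  level_space :> ptopologicalType ;
  level_angle : level_space -> R }.

(* The set of points of F_i at which the branches of F_{i+1} are glued, i.e.
   B_{i+1} when X is F_i. *)
Definition glue_points (i : nat) (X : level) : set X :=
  [set x | exists2 l, (l <= i.+1)%N & vartheta l (level_angle x)].

Definition next_level (i : nat) (X : level) : level :=
  @Level (glue (branch P i.+1) (@glue_points i X))
         (fun q => level_angle (repr q).1).

Fixpoint flevel (i : nat) : level :=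
  if i is i'.+1 then next_level i' (flevel i')
  else @Level (circle R) (@circle_angle R).

Definition Fspace (i : nat) : ptopologicalType := flevel i.

Definition Fproj (i : nat) (x : Fspace i.+1) : Fspace i :=
  (repr (x : glue (branch P i.+1) (@glue_points i (flevel i)))).1.

Fixpoint word (i : nat) : finType :=
  if i is i'.+1 then (word i' * 'I_(npar P i'.+1))%type else unit.

(* [eta w_1 .. w_i] *)
Fixpoint Fpt (i : nat) (eta : R) : word i -> Fspace i :=
  match i return word i -> Fspace i with
  | 0 => fun=> \pi_(circle R) eta
  | i'.+1 => fun w =>
      \pi_(glue (branch P i'.+1) (@glue_points i' (flevel i')))
        (Fpt eta w.1, w.2)
  end.

(* (k, w) stands for (pi k / J_i, w) in A_i. *)
Definition addr (i : nat) : finType := ('I_(2 * J i) * word i)%type.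

Fixpoint word_seq (i : nat) : word i -> seq nat :=
  match i return word i -> seq nat with
  | 0 => fun=> [::]
  | i'.+1 => fun w => rcons (word_seq w.1) w.2
  end.

Definition addr_seq (i : nat) (a : addr i) : seqlexi nat :=
  (a.1 : nat) :: word_seq a.2.

Definition cell_map (i : nat) (a : addr i) (theta : R) : Fspace i :=
  Fpt (pi * a.1%:R / (J i)%:R + theta) a.2.

Definition cell (i : nat) (a : addr i) : set (Fspace i) :=
  cell_map a @` `[0, Lgrid i].

Definition same_bundle (i : nat) (a b : addr i.+1) : bool :=
  (a.1 == b.1) && (a.2.1 == b.2.1).

Fixpoint word0 (i : nat) : word i :=
  match i return word i with
  | 0 => tt
  | i'.+1 => (word0 i', Ordinal (npar_gt0 P i'.+1))
  end.

Lemma double_Jprod_gt0 i : (0 < 2 * J i)%N.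
Proof. by rewrite muln_gt0 Jprod_gt0. Qed.

Definition addr0 (i : nat) : addr i :=
  (Ordinal (double_Jprod_gt0 i), word0 i).

Definition is_coord (i : nat) (x : Fspace i) (c : R * addr i) : Prop :=
  0 <= c.1 < Lgrid i /\ cell_map c.2 c.1 = x.

(* The pair (theta_x, alpha_x), alpha_x being lexicographically smallest; such a
   pair always exists, so that the default (0, addr0 i) is irrelevant. *)
Definition cell_coord (i : nat) (x : Fspace i) : R * addr i :=
  xget (0, addr0 i)
    [set c | is_coord x c /\
       forall c', is_coord x c' -> (addr_seq c.2 <= addr_seq c'.2)%O].

Lemma continuous_Fpt i (w : word i) : continuous (fun eta => Fpt eta w).
Proof.
elim: i w => [|i IH] w.
  exact: (@pi_continuous R {eq_quot (circle_equiv R)}).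
have cw : continuous (fun eta => (Fpt eta w.1, w.2 : branch P i.+1)).
  move=> x.
  exact: (cvg_pair (IH w.1 x) (@cvg_cst (branch P i.+1) w.2 _ (nbhs x) _)).
have cpi := @pi_continuous _
  {eq_quot (glue_equiv (branch P i.+1) (@glue_points i (flevel i)))}.
by move=> x; exact: (continuous_comp (cw x) (cpi _)).
Qed.

Lemma continuous_cell_map i (a : addr i) : continuous (cell_map a).
Proof.
move=> x; apply: (@continuous_comp _ _ _ (fun t : R => _ + t) (fun e => Fpt e a.2)).
  by apply: continuousD; [exact: cst_continuous|move=> ?; exact: cvg_id].
exact: continuous_Fpt.
Qed.

Lemma continuous_borel_measurable (X : ptopologicalType) (f : R -> X) :
  continuous f -> measurable_fun [set: R] (f : R -> borel X).
Proof.
move=> /continuousP cf; apply: (@measurability _ _ _ (borel X) _ _ open erefl).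
by move=> _ [U oU <-]; rewrite setTI; apply: open_measurable; exact: cf.
Qed.

(* mu_i on Borel sets A: the defining formula for the integral against mu_i,
   taken at the indicator function of A. *)
Definition Fmeasure (i : nat) : set (borel (Fspace i)) -> \bar R :=
  match i return set (borel (Fspace i)) -> \bar R with
  | 0 => fun A =>
      lebesgue_measure (`[0, 2 * pi[ `&` (fun t : R => \pi_(circle R) t) @^-1` A)
  | i'.+1 => fun A =>
      (\sum_(a : addr i'.+1) ((N i'.+1)%:R^-1)%:E *
         lebesgue_measure (`[0%R, Lgrid i'.+1] `&` cell_map a @^-1` A))%E
  end.


Lemma Fmeasure0 i : @Fmeasure i set0 = 0%E.
Proof.
case: i => [|i] /=; first by rewrite preimage_set0 setI0 measure0.
by rewrite big1 // => a _; rewrite preimage_set0 setI0 measure0 mule0.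
Qed.

Lemma Fmeasure_ge0 i A : (0 <= @Fmeasure i A)%E.
Proof.
case: i A => [|i] A /=; first exact: measure_ge0.
by apply: sume_ge0 => a _; rewrite mule_ge0 // lee_fin invr_ge0.
Qed.

Lemma arc_sigma_additive (X : ptopologicalType) (f : R -> X) (D : set R) :
  continuous f -> measurable D ->
  semi_sigma_additive
    (fun A : set (borel X) => lebesgue_measure (D `&` f @^-1` A)).
Proof.
move=> cf mD.
have mf := continuous_borel_measurable cf.
have mFD (A : set (borel X)) : measurable A -> measurable (D `&` f @^-1` A).
  by move=> mA; apply: measurableI => //; rewrite -[X in measurable X]setTI;
    exact: mf.
move=> F mF tF mUF; rewrite preimage_bigcup setI_bigcupr.
apply: measure_semi_sigma_additive.
- by move=> n; exact: mFD.
- apply/trivIsetP => k l _ _ kl; rewrite setIACA setIid -preimage_setI.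
  by move/trivIsetP : tF => /(_ _ _ Logic.I Logic.I kl) ->;
    rewrite preimage_set0 setI0.
- by rewrite -setI_bigcupr -preimage_bigcup; exact: mFD.
Qed.

Lemma Fmeasure_semi_sigma_additive i : semi_sigma_additive (@Fmeasure i).
Proof.
case: i => [|i].
  exact: (arc_sigma_additive (@continuous_Fpt 0 tt) (measurable_itv _)).
move=> F mF tF mUF; rewrite [X in _ --> X](_ : _ =
    limn (fun m => \sum_(0 <= k < m) Fmeasure (F k))%E).
  by apply: is_cvg_ereal_nneg_natsum => k _; exact: Fmeasure_ge0.
have c_ge0 : (0 <= ((N i.+1)%:R^-1)%:E :> \bar R)%E by rewrite lee_fin invr_ge0.
rewrite /= nneseries_sum; last by move=> a k _; rewrite mule_ge0.
apply: eq_bigr => a _; rewrite nneseriesZl; last by move=> k _.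
congr (_ * _)%E; apply/esym/cvg_lim => //.
exact: (arc_sigma_additive (@continuous_cell_map _ a) (measurable_itv _)).
Qed.

HB.instance Definition _ i := isMeasure.Build _ _ _ (@Fmeasure i)
  (@Fmeasure0 i) (@Fmeasure_ge0 i) (@Fmeasure_semi_sigma_additive i).

Definition kernelF0 (t : R) (x y : Fspace 0) : R :=
  let th1 := circle_angle x in let th2 := circle_angle y in
  1 / (2 * pi) + 1 / pi *
    \big[+%R/0]_(1 <= k <oo) (expR (- (k%:R ^+ 2 * t)) * cos (k%:R * (th2 - th1))).

Definition kernelD (i : nat) (t th1 th2 : R) : R :=
  2 / Lgrid i * \big[+%R/0]_(1 <= k <oo)
    (expR (- (k%:R ^+ 2 * pi ^+ 2 * t / Lgrid i ^+ 2)) *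
      sin (k%:R * pi * th1 / Lgrid i) * sin (k%:R * pi * th2 / Lgrid i)).

Definition bundle_coef (i : nat) (x y : Fspace i.+1) : R :=
  let a := (cell_coord x).2 in let b := (cell_coord y).2 in
  if ~~ same_bundle a b then 0
  else if a != b then -1
  else (npar P i.+1)%:R - 1.

Fixpoint kernelF (t : R) (i : nat) : Fspace i -> Fspace i -> R :=
  match i return Fspace i -> Fspace i -> R with
  | 0 => kernelF0 t
  | i'.+1 => fun x y =>
      kernelF t (Fproj x) (Fproj y) +
      bundle_coef x y * (N i')%:R *
        kernelD i'.+1 t (cell_coord x).1 (cell_coord y).1
  end.

Definition semigroupF (i : nat) (t : R) (f : Fspace i -> R) (x : Fspace i) : R :=
  if t == 0 then f x
  else \int[@Fmeasure i]_y (kernelF t x y * f y).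

Definition compatible : set (prod_topology Fspace) :=
  [set x : forall i, Fspace i | forall i, Fproj (x i.+1) = x i].

Definition Finf : Type := set_type compatible.

Definition Fpoint (i : nat) : Fspace i := Fpt 0 (word0 i).

Lemma Fproj_Fpt i eta (w : word i.+1) : Fproj (Fpt eta w) = Fpt eta w.1.
Proof.
pose Q := {eq_quot (glue_equiv (branch P i.+1) (@glue_points i (flevel i)))}.
pose p : Fspace i * branch P i.+1 := (Fpt eta w.1, w.2).
have : glue_rel (@glue_points i (flevel i)) (repr (\pi_Q p)) p.
  have /eqmodP : \pi_Q (repr (\pi_Q p)) = \pi_Q p by rewrite reprK.
  by [].
by move=> /asboolP[].
Qed.

Lemma Fpoint_compatible : compatible Fpoint.
Proof. by move=> i; rewrite /Fpoint Fproj_Fpt. Qed.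

HB.instance Definition _ := Topological.on Finf.
HB.instance Definition _ := isPointed.Build Finf
  (exist _ (Fpoint : prod_topology Fspace) (mem_set Fpoint_compatible)).

Definition Phi (i : nat) (x : Finf) : Fspace i :=
  (set_val x : prod_topology Fspace) i.

Definition bundle_levels (x y : Finf) : set nat :=
  [set i | exists m, i = m.+1 /\
     exists a b : addr m.+1,
       [/\ same_bundle a b, cell a (Phi m.+1 x) & cell b (Phi m.+1 y)]].

(* fset_set is the finite set underlying bundle_levels x y; istar is only used
   when bundle_levels x y is finite. *)
Definition istar (x y : Finf) : nat :=
  \max_(i <- fset_set (bundle_levels x y)) i.

Definition kernelFinf (t : R) (x y : Finf) : R :=
  if `[< finite_set (bundle_levels x y) >] then
    kernelF t (Phi (istar x y) x) (Phi (istar x y) y)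
  else limn (fun i => kernelF t (Phi i x) (Phi i y)).

End Diamond.

(* A genuine norm on C(X) for X compact, such as Finf; sup is 0 on unbounded
   sets. *)
Definition supnorm (R : realType) (X : Type) (f : X -> R) : R :=
  sup [set `|f x| | x in [set: X]].

(* Only the values of T t f for 0 <= t and f continuous are relevant. *)
Record markov_semigroup (R : realType) (X : topologicalType)
    (T : R -> (X -> R) -> X -> R) : Prop := {
  ms_continuous : forall (t : R) (f : X -> R),
    0 <= t -> continuous f -> continuous (T t f) ;
  ms_linear : forall (t a : R) (f g : X -> R),
    0 <= t -> continuous f -> continuous g ->
    forall x, T t (fun z => a * f z + g z) x = a * T t f x + T t g x ;
  ms_id : forall f : X -> R, continuous f -> T 0 f = f ;
  ms_semigroup : forall (s t : R) (f : X -> R),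
    0 <= s -> 0 <= t -> continuous f -> T (s + t) f = T s (T t f) ;
  ms_strong : forall f : X -> R, continuous f ->
    supnorm (fun x => T t f x - f x) @[t --> 0^'+] --> (0 : R) ;
  ms_positive : forall (t : R) (f : X -> R), 0 <= t -> continuous f ->
    (forall x, 0 <= f x) -> forall x, 0 <= T t f x ;
  ms_contractive : forall (t : R) (f : X -> R), 0 <= t -> continuous f ->
    supnorm (T t f) <= supnorm f }.

Definition diffusion_semigroup (R : realType) (P : diamond_params)
    (T : R -> (Finf R P -> R) -> Finf R P -> R) : Prop :=
  markov_semigroup T /\
  forall (i : nat) (t : R) (f : Fspace R P i -> R), 0 <= t -> continuous f ->
    T t (f \o @Phi R P i) = semigroupF t f \o @Phi R P i.

Definition limit_measure (R : realType) (P : diamond_params)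
    (mu : {measure set (borel (Finf R P)) -> \bar R}) : Prop :=
  forall (i : nat) (A : set (borel (Fspace R P i))), measurable A ->
    mu (@Phi R P i @^-1` A) = Fmeasure A.

Definition is_heat_kernel (R : realType) (X : ptopologicalType)
    (mu : {measure set (borel X) -> \bar R})
    (T : R -> (X -> R) -> X -> R) (p : R -> X -> X -> R) : Prop :=
  forall (t : R) (f : X -> R) (x : X), 0 < t -> continuous f ->
    mu.-integrable [set: borel X] (fun y => (p t x y * f y)%:E) /\
    T t f x = \int[mu]_y (p t x y * f y).

(* Main.v *)
From mathcomp Require Import all_boot all_order all_algebra.
From mathcomp Require Import all_classical all_reals all_analysis.
From mathcomp Require Import finmap measurable_realfun ring lra zify.
Require Import Defs.

(* For fixed t > 0 the increments p^{F_i} - p^{F_(i-1)} are bounded uniformly by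
   a constant times N_i J_i exp (- J_i^2 t), which decays geometrically by the
   hypothesis and J_i >= 2^i.  So p^{F_i} (Phi_i x, Phi_i y) converges uniformly;
   as the increments vanish above level i_*, the limit is the claimed kernel.
   Each p^{F_i} is continuous in y because the Dirichlet kernel vanishes at the
   ends of the cells.
   Given f in C(F_oo), let f_n be f composed with Phi_n and then with a continuous
   section F_n -> F_oo of Phi_n.  Since F_oo is compact, f_n tends to f uniformly,
   and the formula follows by letting n tend to oo in
   T_t f_n (x) = int p^{F_n} (Phi_n x, Phi_n y) f_n (y) mu(dy),
   using the contractivity of T_t on the left-hand side. *)

Import Order.TTheory GRing.Theory Num.Theory.
Import numFieldNormedType.Exports.

Set Implicit Arguments.
Unset Strict Implicit.
Unset Printing Implicit Defensive.

Local Open Scope classical_set_scope.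
Local Open Scope ring_scope.
Local Open Scope quotient_scope.

(** * Uniform limits with geometric increments *)

Section GeometricLimits.
Context (R : realType) (K q : R).
Context (q0 : 0 <= q) (q1 : q < 1).

Lemma geometric_step_cvg (v : R^nat) :
  (forall n, `|v n.+1 - v n| <= K * q ^+ n) -> cvgn v.
Proof.
move=> hv.
have nq1 : `|q| < 1 by rewrite ger0_norm.
have cs : cvgn (series (telescope v)).
  apply: normed_cvg; apply: (series_le_cvg _ _ hv).
  - by move=> n; exact: normr_ge0.
  - by move=> n; exact: le_trans (hv n).
  - exact: (@is_cvg_geometric_series _ K q nq1).
have -> : v = (fun n => v 0%N + series (telescope v) n).
  by apply/funext => n; exact: eq_sum_telescope.
by apply: is_cvgD => //; exact: is_cvg_cst.
Qed.

Lemma geometric_step_tail (v : R^nat) n :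
  (forall n, `|v n.+1 - v n| <= K * q ^+ n) ->
  `|limn v - v n| <= K * q ^+ n / (1 - q).
Proof.
move=> hv; have cv := geometric_step_cvg hv.
have q1' : 0 < 1 - q by rewrite subr_gt0.
(* The sign of [K] is forced by the hypothesis at index 0, where [q ^+ 0] is 1. *)
have K0 : 0 <= K.
  by have := le_trans (normr_ge0 _) (hv 0%N); rewrite expr0 mulr1.
have part k : `|v (n + k)%N - v n| <= K * q ^+ n * (1 - q ^+ k) / (1 - q).
  elim: k => [|k IH]; first by rewrite addn0 subrr normr0 expr0 subrr mulr0 mul0r.
  rewrite addnS -(subrKA (v (n + k)%N)).
  apply: le_trans (ler_normD _ _) _; apply: le_trans (lerD (hv _) IH) _.
  rewrite le_eqVlt; apply/orP; left; apply/eqP.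
  rewrite exprS exprD; field; exact: lt0r_neq0.
have cvn : cvgn (fun m => `|v m - v n|).
  by apply: is_cvg_norm; apply: is_cvgB => //; exact: is_cvg_cst.
have -> : `|limn v - v n| = limn (fun m => `|v m - v n|).
  apply/esym/cvg_lim => //; apply: cvg_norm; apply: cvgB => //; exact: cvg_cst.
apply: limr_le => //; near=> m.
have -> : m = (n + (m - n))%N by rewrite subnKC //; near: m; exact: nbhs_infty_ge.
apply: le_trans (part _) _.
rewrite ler_pM2r ?invr_gt0 // ler_piMr ?mulr_ge0 ?exprn_ge0 //.
by rewrite gerBl exprn_ge0.
Unshelve. all: by end_near. Qed.

Lemma cvg_geometric_tail : (fun n => K * q ^+ n / (1 - q)) @ \oo --> 0.
Proof.
have nq1 : `|q| < 1 by rewrite ger0_norm.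
rewrite -(mul0r ((1 - q)^-1)); apply: cvgM; last exact: cvg_cst.
exact: (@cvg_geometric _ K q nq1).
Qed.

(** The tail bound does not depend on the point, so convergence is uniform and the [e / 3] argument
    applies. *)
Lemma geometric_step_continuous (X : topologicalType) (v : nat -> X -> R) :
  (forall n x, `|v n.+1 x - v n x| <= K * q ^+ n) ->
  (forall n, continuous (v n)) -> continuous (fun x => limn (v ^~ x)).
Proof.
move=> hv cv x; apply/cvgrPdist_le => e e0.
have e3 : 0 < e / 3 by rewrite divr_gt0.
have [n _ hn] : \forall n \near \oo, K * q ^+ n / (1 - q) <= e / 3.
  have := cvg_geometric_tail => /cvgrPdist_le /(_ _ e3); apply: filterS => n.
  by rewrite sub0r normrN; apply: le_trans; exact: ler_norm.
have {}hn := hn n (leqnn n).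
have tl y : `|limn (v ^~ y) - v n y| <= e / 3.
  by apply: le_trans hn; apply: geometric_step_tail => k; exact: hv.
have /cvgrPdist_le/(_ _ e3) := cv n x; apply: filterS => y hy.
have -> : limn (v ^~ x) - limn (v ^~ y) = (limn (v ^~ x) - v n x) +
  ((v n x - v n y) - (limn (v ^~ y) - v n y)) by ring.
have -> : e = e / 3 + (e / 3 + e / 3) by field.
apply: le_trans (ler_normD _ _) (lerD (tl x) _).
exact: le_trans (ler_normB _ _) (lerD hy (tl y)).
Qed.

End GeometricLimits.

Lemma continuous_sum_nat (R : realType) (X : topologicalType)
  (f : nat -> X -> R) m n : (forall k, continuous (f k)) ->
  continuous (fun x => \sum_(m <= k < n) f k x).
Proof.
move=> cf; elim: n => [|n IH].
  by under eq_fun do rewrite big_geq //; exact: cst_continuous.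
have [mn|mn] := leqP m n; last first.
  by under eq_fun do rewrite big_geq //; exact: cst_continuous.
under eq_fun do rewrite big_nat_recr //=.
by move=> x; apply: cvgD; [exact: IH|exact: cf].
Qed.

Lemma continuous_measurable_real (R : realType) (X : ptopologicalType)
  (f : X -> R) : continuous f -> measurable_fun [set: borel X] (f : borel X -> R).
Proof.
move=> /continuousP cf; apply: (measurability _ (RGenOpens.measurableE R)).
move=> _ [_ [a [b ->] <-]]; rewrite setTI; apply: sub_sigma_algebra.
by apply: cf; exact: interval_open.
Qed.

Lemma continuous_borel (X Y : ptopologicalType) (f : X -> Y) :
  continuous f -> measurable_fun [set: borel X] (f : borel X -> borel Y).
Proof.
move=> /continuousP cf; apply: (@measurability _ _ _ (borel Y) _ _ open erefl).
by move=> _ [U oU <-]; rewrite setTI; apply: sub_sigma_algebra; exact: cf.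
Qed.

Section Supnorm.
Context (R : realType) (X : topologicalType).
Context (cX : compact [set: X]).

Lemma continuous_norm_bounded (f : X -> R) : continuous f ->
  exists M, forall x, `|f x| <= M.
Proof.
move=> cf.
have /compact_bounded[M [_ hM]] : compact (range f).
  by apply: continuous_compact => //; exact: continuous_subspaceT.
by exists (M + 1) => x; apply: hM; [rewrite ltrDl|exists x].
Qed.

(** Compactness bounds the values of [f]; on an unbounded set [sup] would be 0. *)
Lemma le_supnorm (f : X -> R) x : continuous f -> `|f x| <= supnorm f.
Proof.
move=> /continuous_norm_bounded[M hM]; apply: ub_le_sup; last by exists x.
by exists M => _ [y _ <-].
Qed.

Lemma supnorm_le (f : X -> R) M : 0 <= M -> (forall x, `|f x| <= M) ->
  supnorm f <= M.
Proof.
move=> M0 hM; rewrite /supnorm.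
(* For empty [X] the set of values is empty and its [sup] is 0, which is where [0 <= M] enters. *)
have [->|/set0P ne] := eqVneq [set `|f x| | x in [set: X]] set0.
  by rewrite sup0.
by apply: ge_sup => // _ [x _ <-].
Qed.

End Supnorm.

(** * The spaces [F_i] *)

Lemma continuous_pair_discrete (X Y : topologicalType)
  (W : discreteTopologicalType) (f : X * W -> Y) :
  (forall w, continuous (fun x => f (x, w))) -> continuous f.
Proof.
move=> cf [x w] U /(cf w x) hU; exists ([set x' | U (f (x', w))], [set w]).
  by split => //=; exact: discrete_set1.
by move=> [x' w'] /= [h ->].
Qed.

Section Levels.
Context (R : realType) (P : diamond_params).

Local Notation F := (Fspace R P).
Local Notation J := (Jprod P).
Local Notation N := (Nprod P).
Local Notation L := (Lgrid R P).

Definition Fglue i (p : F i * branch P i.+1) : F i.+1 :=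
  (\pi_(glue (branch P i.+1) (@glue_points R P i (flevel R P i))) p)%qT.

Lemma Fpt_succ i eta (w : word P i.+1) :
  Fpt eta w = Fglue (Fpt eta w.1, w.2).
Proof. by []. Qed.

Lemma continuous_Fglue i : continuous (@Fglue i).
Proof.
exact: (@pi_continuous _ {eq_quot (glue_equiv (branch P i.+1)
  (@glue_points R P i (flevel R P i)))}).
Qed.

Lemma continuous_from_Fglue i (Y : topologicalType) (h : F i.+1 -> Y) :
  continuous (h \o @Fglue i) -> continuous h.
Proof.
by move=> ch; apply/(@quotient_continuous _ {eq_quot (glue_equiv (branch P i.+1)
  (@glue_points R P i (flevel R P i)))}).
Qed.

Lemma FglueK i (x : F i.+1) : exists p, Fglue p = x.
Proof. by exists (repr (x : glue _ _)); exact: reprK. Qed.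

Lemma eq_Fglue i (p q : F i * branch P i.+1) : Fglue p = Fglue q ->
  p.1 = q.1 /\ (p.2 = q.2 \/ glue_points P i p.1).
Proof.
by move=> /(@eqmodP _ (glue_equiv (branch P i.+1)
  (@glue_points R P i (flevel R P i))))/asboolP.
Qed.

Lemma Fproj_Fglue i (p : F i * branch P i.+1) : Fproj (Fglue p) = p.1.
Proof.
have /eq_Fglue[] // : Fglue (repr (Fglue p : glue _ _)) = Fglue p by exact: reprK.
Qed.

Lemma Fpt_surj i (x : F i) : exists eta (w : word P i), Fpt eta w = x.
Proof.
elim: i x => [|i IH] x; first by exists (repr (x : circle R)), tt; exact: reprK.
have [[y b] <-] := FglueK x; have [eta [w <-]] := IH y.
by exists eta, (w, b).
Qed.

(** As an iterated quotient of copies of the real line, [F i] has the final topology for the maps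
    [Fpt ^~ w]. Continuity on [F i] thus reduces to functions of one real variable. *)
Lemma continuous_from_Fpt i (Y : topologicalType) (h : F i -> Y) :
  (forall w : word P i, continuous (fun eta => h (Fpt eta w))) -> continuous h.
Proof.
elim: i Y h => [|i IH] Y h ch.
  apply/(@quotient_continuous R {eq_quot (circle_equiv R)}).
  exact: (ch tt).
apply: continuous_from_Fglue; apply: continuous_pair_discrete => b.
by apply: IH => w; exact: (ch (w, b)).
Qed.

Lemma continuous_Fproj i : continuous (@Fproj R P i).
Proof.
apply: continuous_from_Fpt => w; under eq_fun do rewrite Fproj_Fpt.
exact: continuous_Fpt.
Qed.

Lemma Jprod_succ i : J i.+1 = (J i * jpar P i.+1)%N.
Proof. by rewrite /Jprod big_nat_recr. Qed.

Lemma Nprod_succ i : N i.+1 = (N i * npar P i.+1)%N.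
Proof. by rewrite /Nprod big_nat_recr. Qed.

Lemma Jprod0 : J 0 = 1%N.
Proof. by rewrite /Jprod big_nil. Qed.

Lemma dvdn_Jprod l i : (l <= i)%N -> (J l %| J i)%N.
Proof.
move=> /subnKC <-; elim: (i - l)%N => [|k IH]; first by rewrite addn0.
by rewrite addnS Jprod_succ dvdn_mulr.
Qed.

Lemma Jprod_exp2 i : (2 ^ i <= J i)%N.
Proof.
elim: i => [|i IH]; first by rewrite Jprod0.
by rewrite Jprod_succ expnSr leq_mul // jpar_ge2.
Qed.

Lemma JprodR_gt0 i : 0 < (J i)%:R :> R.
Proof. by rewrite ltr0n Jprod_gt0. Qed.

Lemma Lgrid_gt0 i : 0 < L i.
Proof. by rewrite divr_gt0 // ?pi_gt0 // JprodR_gt0. Qed.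

Lemma double_Jprod_Lgrid i : (2 * J i)%:R * L i = 2 * pi :> R.
Proof.
have := lt0r_neq0 (JprodR_gt0 i); rewrite /Lgrid natrM => ?; by field.
Qed.

Lemma pi_circle_eq (x y : R) :
  (\pi_(circle R) x = \pi_(circle R) y)%qT <-> exists k : int, x - y = 2 * pi * k%:~R.
Proof.
split=> [/(@eqmodP _ (circle_equiv R))/asboolP //|h].
by apply/(@eqmodP _ (circle_equiv R))/asboolP.
Qed.

Lemma Fpt_period i (eta : R) (k : int) (w : word P i) :
  Fpt (eta + 2 * pi * k%:~R) w = Fpt eta w.
Proof.
elim: i w => [|i IH] w; last by rewrite !Fpt_succ IH.
by apply/pi_circle_eq; exists k; rewrite addrAC subrr add0r.
Qed.

Lemma circle_angleP (x : circle R) :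
  0 <= circle_angle x < 2 * pi /\ (\pi_(circle R) (circle_angle x))%qT = x.
Proof.
apply: (@getPex _ [set t : R | 0 <= t < 2 * pi /\ (\pi_(circle R) t)%qT = x]).
(* The set from which [get] chooses is inhabited: subtract from a representative [r] its number [m]
   of full turns. *)
have pi2 : 0 < 2 * pi :> R by rewrite mulr_gt0 // pi_gt0.
pose r := repr x; pose m := Num.floor (r / (2 * pi)).
exists (r - 2 * pi * m%:~R); split; last first.
  rewrite -[RHS]reprK; apply/pi_circle_eq; exists (- m).
  by rewrite rmorphN /= mulrN addrAC subrr add0r.
have /andP[h1 h2] := floor_itv (r / (2 * pi)).
rewrite ler_pdivlMr // in h1; rewrite ltr_pdivrMr // in h2.
rewrite intrD in h2.
by apply/andP; split; lra.
Qed.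

Lemma level_angle_Fpt i (eta : R) (w : word P i) :
  exists k : int, level_angle (Fpt eta w : flevel R P i) = eta + 2 * pi * k%:~R.
Proof.
elim: i w => [|i IH] w.
  have [_ /pi_circle_eq[k hk]] := circle_angleP (\pi_(circle R) eta)%qT.
  by exists k; rewrite -hk addrC subrK.
have [k hk] := IH w.1; exists k; rewrite -hk.
(* By definition, the angle at level [i.+1] is the angle of the first component of the
   representative, that is, of [Fproj]. *)
change (level_angle (Fproj (Fpt eta w) : flevel R P i) =
        level_angle (Fpt eta w.1 : flevel R P i)).
by rewrite Fproj_Fpt.
Qed.

(** The grids are nested because [J l] divides [J i]. *)
Lemma vartheta_grid l i (x : R) : (l <= i)%N -> vartheta P l x ->
  exists k : int, x = k%:~R * L i.
Proof.
move=> li; have [l0|l0] := eqVneq l 0%N.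
  have Ji := lt0r_neq0 (JprodR_gt0 i); rewrite /vartheta l0 /= => -[->|->].
    by exists 0; rewrite mul0r.
  by exists (J i)%:Z; rewrite -pmulrn /Lgrid mulrC divfK.
rewrite /vartheta (negbTE l0) => -[k _ <-].
have /dvdnP[m hm] := dvdn_Jprod li; exists (k * m)%:Z.
have := JprodR_gt0 i; have := JprodR_gt0 l; rewrite /Lgrid hm !natrM => Jl.
rewrite pmulr_lgt0 // => m0.
have := lt0r_neq0 Jl; have := lt0r_neq0 m0 => ? ?.
by rewrite -pmulrn natrM; field; apply/andP.
Qed.

(** Distinct words can name the same point only through a gluing, and level [i] glues only over
    angles in the grid of step [L i]. *)
Lemma Fpt_eq i (eta eta' : R) (w w' : word P i) : Fpt eta w = Fpt eta' w' ->
  (exists k : int, eta - eta' = 2 * pi * k%:~R) /\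
  (w = w' \/ exists k : int, eta = k%:~R * L i).
Proof.
elim: i w w' => [|i IH] w w'.
  by move=> /pi_circle_eq ?; split => //; left; case: w w' => -[].
rewrite !Fpt_succ => /eq_Fglue /= [e1 e2].
have [? e3] := IH _ _ e1; split => //.
case: e2 => [e2|[l li /(vartheta_grid li)[k hk]]]; last first.
  right; have [m hm] := level_angle_Fpt eta w.1; move: hk; rewrite hm => hk.
  (* The angle of the point differs from [eta] by [m] full turns, each worth [2 * J i.+1] grid
     steps. *)
  exists (k - m * (2 * J i.+1)%:Z); rewrite -[LHS](addrK (2 * pi * m%:~R)) hk.
  by rewrite -(double_Jprod_Lgrid i.+1) rmorphB rmorphM /= -pmulrn; ring.
case: e3 => [e3|[k hk]].
  by left; case: w w' e1 e2 e3 => [? ?] [? ?] /= _ -> ->.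
(* A gluing at an earlier level: one step of the coarser grid is [jpar P i.+1] steps of the finer
   one. *)
right; exists (k * (jpar P i.+1)%:Z); rewrite hk /Lgrid Jprod_succ natrM.
have := jpar_gt0 P i.+1; rewrite -(ltr0n R) => /lt0r_neq0 ?.
have /lt0r_neq0 ? := JprodR_gt0 i.
by rewrite rmorphM /= -pmulrn; field; apply/andP.
Qed.

End Levels.

(** * Cell coordinates and heat kernels *)

Section Kernels.
Context (R : realType) (P : diamond_params).

Local Notation F := (Fspace R P).
Local Notation J := (Jprod P).
Local Notation L := (Lgrid R P).

Lemma cell_mapE i (a : addr P i) (th : R) :
  cell_map a th = Fpt (a.1%:R * L i + th) a.2.
Proof. by rewrite /cell_map /Lgrid mulrA (mulrC pi). Qed.

(** Addresses only store indices below [2 * J i]; reducing [m] modulo this number changes the angle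
    by full turns, which [Fpt] ignores. *)
Lemma grid_addr i (m : int) (w : word P i) : exists a : addr P i,
  forall th : R, cell_map a th = Fpt (m%:~R * L i + th) w.
Proof.
pose D : int := (2 * J i)%:Z.
have D0 : D != 0 by rewrite /D eqz_nat -lt0n double_Jprod_gt0.
have r0 : 0 <= (m %% D)%Z by exact: modz_ge0.
have rE : (`|(m %% D)%Z|%N : int) = (m %% D)%Z by exact: gez0_abs.
have rlt : (`|(m %% D)%Z| < 2 * J i)%N.
  by rewrite -ltz_nat rE ltz_pmod // ltz_nat double_Jprod_gt0.
exists (Ordinal rlt, w) => th; rewrite cell_mapE /= -(Fpt_period _ (m %/ D)%Z).
congr Fpt; rewrite -(double_Jprod_Lgrid R P i) [in RHS](divz_eq m D) -rE.
rewrite intrD intrM -!pmulrn; ring.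
Qed.

Lemma int_lt_norm1 (n : int) (r : R) : 0 < r -> `|n%:~R * r| < r -> n = 0.
Proof.
move=> r0; rewrite normrM (gtr0_norm r0) gtr_pMl // -intr_norm -[1]/(1%:~R) ltr_int.
by rewrite -[1%R]/(0 + 1 : int) ltzD1 normr_le0 => /eqP.
Qed.

(** A nonzero local coordinate means that the point is interior to its cell, away from every
    gluing. *)
Lemma is_coord_uniq i (x : F i) c c' : is_coord x c -> is_coord x c' ->
  c.1 != 0 -> c = c'.
Proof.
case: c c' => [th [a w]] [th' [a' w']] [/andP[/= t0 tL] <-] [/andP[/= t0' tL']].
have L0 := Lgrid_gt0 R P i.
rewrite !cell_mapE /= => /esym/Fpt_eq[[k]]; rewrite -(double_Jprod_Lgrid R P i).
move=> hk hw th0.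
(* Otherwise the angle is a grid point, so [th] is a multiple of [L i] in [[0, L i)] and
   vanishes. *)
have eqw : w = w'.
  case: hw => // -[m hm]; case/eqP: th0.
  have e : th = (m - a%:Z)%:~R * L i by rewrite rmorphB /= -pmulrn mulrBl -hm; ring.
  have z : m - a%:Z = 0 by apply: (@int_lt_norm1 _ (L i)) => //; rewrite -e ger0_norm.
  by rewrite e z mul0r.
(* The difference of the local coordinates is an integer multiple of [L i] of absolute value below
   [L i], hence 0. *)
have e : ((a : nat)%:Z - (a' : nat)%:Z - (2 * J i)%:Z * k)%:~R * L i = th' - th.
  rewrite !rmorphB rmorphM /= -!pmulrn.
  suff: (a%:R - a'%:R) * L i + (th - th') = (2 * J i)%:R * L i * k%:~R by move=> h; nra.
  by rewrite -hk; ring.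
have z : (a : nat)%:Z - (a' : nat)%:Z - (2 * J i)%:Z * k = 0.
  apply: (@int_lt_norm1 _ (L i)) => //; rewrite e ltr_norml; apply/andP; split; lra.
have tt' : th = th' by apply/eqP; rewrite eq_sym -subr_eq0 -e z mul0r.
(* The indices now differ by a multiple of [2 * J i] while both lie below it, so the multiple is
   0. *)
have aa' : a = a'.
  apply: val_inj => /=.
  have := ltn_ord a; have := ltn_ord a'; move: z.
  set b := nat_of_ord a; set b' := nat_of_ord a'; set D := (2 * J i)%N => z b'D bD.
  clearbody b b' D; have [k0|k0|k0] := ltgtP k 0; last by move: z; rewrite k0; lia.
    have : D%:Z * (k + 1) <= 0 by rewrite mulr_ge0_le0 //; lia.
    by rewrite mulrDr mulr1; lia.
  have : 0 <= D%:Z * (k - 1) by rewrite mulr_ge0 //; lia.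
  by rewrite mulrBr mulr1; lia.
by rewrite tt' aa' eqw.
Qed.

Lemma is_coord_ex i (x : F i) : exists c, is_coord x c.
Proof.
have [eta [w <-]] := Fpt_surj x; have L0 := Lgrid_gt0 R P i.
have [a ha] := grid_addr (Num.floor (eta / L i)) w.
have /andP[h1 h2] := floor_itv (eta / L i).
rewrite ler_pdivlMr // in h1; rewrite ltr_pdivrMr // intrD mulrDl mul1r in h2.
exists (eta - (Num.floor (eta / L i))%:~R * L i, a); split => /=; last first.
  by rewrite ha addrC subrK.
by apply/andP; split; lra.
Qed.

(** As there are finitely many addresses, a lexicographically least one exists and [xget] does not
    return its default. *)
Lemma cell_coordP i (x : F i) : is_coord x (cell_coord x).
Proof.
pose S := [set c : R * addr P i | is_coord x c /\
  forall c', is_coord x c' -> (addr_seq c.2 <= addr_seq c'.2)%O].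
suff [c Sc] : exists c, S c by have [] := xgetPex (0, Defs.addr0 P i) (ex_intro S c Sc).
have [[th0 a0] h0] := is_coord_ex x.
pose A : pred (addr P i) := fun a => `[< exists th, is_coord x (th, a) >].
have Aa0 : A a0 by apply/asboolP; exists th0.
case: (arg_minP (fun a => addr_seq a) Aa0) => a /asboolP[th h] mina.
exists (th, a); split => // -[th' a'] h' /=; apply: mina.
by apply/asboolP; exists th'.
Qed.

Lemma kernelD_th2_0 i t th : kernelD P i t th 0 = 0 :> R.
Proof.
rewrite /kernelD (_ : (fun n => _) = cst 0) ?lim_cst ?mulr0 //.
by apply/funext => n; rewrite big1 // => k _; rewrite mulr0 mul0r sin0 mulr0.
Qed.

Lemma sin_natpi k : sin (k%:R * pi) = 0 :> R.
Proof.
by rewrite -[k%:R * pi]add0r mulr_natl (alternatingn (@sinDpi R)) sin0 mulr0.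
Qed.

Lemma kernelD_th2_L i t th : kernelD P i t th (L i) = 0 :> R.
Proof.
rewrite /kernelD (_ : (fun n => _) = cst 0) ?lim_cst ?mulr0 //.
apply/funext => n; rewrite big1 // => k _.
by rewrite mulfK ?lt0r_neq0 ?Lgrid_gt0 // sin_natpi mulr0.
Qed.

(** [bundle_coef] read on addresses instead of points, so that the address of [x] can be fixed while
    the point [y] varies. *)
Definition addr_coef i (a b : addr P i.+1) : R :=
  if ~~ same_bundle a b then 0
  else if a != b then -1 else (npar P i.+1)%:R - 1.

Lemma addr_coef_bound i (a b : addr P i.+1) :
  `|addr_coef a b| <= (npar P i.+1)%:R.
Proof.
have n2 : (2 : R) <= (npar P i.+1)%:R by rewrite ler_nat npar_ge2.
rewrite /addr_coef; case: ifP => _; first by rewrite normr0; lra.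
case: ifP => _; first by rewrite normrN normr1; lra.
by rewrite ger0_norm; lra.
Qed.

(** The choice made by [cell_coord] is ambiguous only at ends of cells, where the Dirichlet kernel
    vanishes. The correction may therefore be computed in any closed cell of the line [Fpt ^~ w]
    containing the point. *)
Lemma addr_coef_kernelD i t ax thx eta (w : word P i.+1) (m : int) a :
  m%:~R * L i.+1 <= eta <= (m + 1)%:~R * L i.+1 ->
  (forall th : R, cell_map a th = Fpt (m%:~R * L i.+1 + th) w) ->
  let c := cell_coord (Fpt eta w : F i.+1) in
  addr_coef ax c.2 * kernelD P i.+1 t thx c.1 =
  addr_coef ax a * kernelD P i.+1 t thx (eta - m%:~R * L i.+1).
Proof.
move=> /andP[h1]; rewrite intrD mulrDl mul1r => h2 ha c.
have hc : is_coord _ c := cell_coordP _.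
have L0 := Lgrid_gt0 R P i.+1.
have key c' : is_coord (Fpt eta w) c' ->
    addr_coef ax c.2 * kernelD P i.+1 t thx c.1 =
    addr_coef ax c'.2 * kernelD P i.+1 t thx c'.1.
  move=> hc'; have [c0|/(is_coord_uniq hc hc')-> //] := eqVneq c.1 0.
  have [c0'|/(is_coord_uniq hc' hc)-> //] := eqVneq c'.1 0.
  by rewrite c0 c0' kernelD_th2_0 !mulr0.
(* The right end is excluded from [[0, L)]: there the point has coordinate 0 in the next cell, and
   both kernels vanish. *)
move: h2; rewrite le_eqVlt => /orP[/eqP e|h2].
  have [a' ha'] := grid_addr (m + 1) w.
  rewrite (key (0, a')) /=; last first.
    by split => /=; [apply/andP|rewrite ha' intrD mulrDl mul1r addr0 e].
  by rewrite e addrAC subrr add0r kernelD_th2_L kernelD_th2_0 !mulr0.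
apply: (key (_, a)); split => /=; last by rewrite ha addrC subrK.
by rewrite subr_ge0 h1 ltrBlDl.
Qed.

(** * Estimates for the eigenfunction series *)

Section Series.
Context (t : R) (t0 : 0 < t).

Let q := expR (- t).
Let q0 : 0 <= q. Proof. exact: expR_ge0. Qed.
Let q1 : q < 1. Proof. by rewrite /q expR_lt1 oppr_lt0. Qed.

(** The bound separates decay in [A] from geometric decay in [k]. It serves with [A] equal to [J i]
    squared for the Dirichlet series and to 1 for the circle. *)
Lemma expR_square_geometric (A : R) k : 1 <= A -> (1 <= k)%N ->
  expR (- (k%:R ^+ 2 * A * t)) <= expR (t - A * t) * q ^+ k.
Proof.
move=> A1 k1; rewrite -expRM_natl -expRD ler_expR.
have k1' : (1 : R) <= k%:R by rewrite ler1n.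
(* Without the factor [t], this is the difference of exponents [k^2 A - A + 1 - k], split into
   manifestly nonnegative terms. *)
have : 0 <= t * ((k%:R - 1) * (k%:R + 1) * (A - 1) + k%:R * (k%:R - 1)).
  apply: mulr_ge0; first exact: ltW.
  by apply: addr_ge0; [apply: mulr_ge0; [apply: mulr_ge0|]|apply: mulr_ge0]; lra.
nra.
Qed.

Lemma geometric_series_step (A : R) (u : nat -> R) : 1 <= A ->
  (forall k, (1 <= k)%N -> `|u k| <= expR (- (k%:R ^+ 2 * A * t))) ->
  forall n, `|\sum_(1 <= k < n.+1) u k - \sum_(1 <= k < n) u k| <=
            expR (t - A * t) * q ^+ n.
Proof.
(* At index 0 both sums are empty, since the summation starts at 1. *)
move=> A1 hu [|n].
  by rewrite !big_geq // subrr normr0 mulr_ge0 ?exprn_ge0 ?expR_ge0.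
rewrite big_nat_recr //= addrAC subrr add0r.
by apply: le_trans (hu _ _) _ => //; exact: expR_square_geometric.
Qed.

(** Since [L i] is [pi / J i], the Dirichlet eigenvalues are [k^2 (J i)^2]. *)
Lemma kernelD_termE i k th th' :
  expR (- (k%:R ^+ 2 * pi ^+ 2 * t / L i ^+ 2)) *
    sin (k%:R * pi * th / L i) * sin (k%:R * pi * th' / L i) =
  expR (- (k%:R ^+ 2 * (J i)%:R ^+ 2 * t)) *
    (sin (k%:R * pi * th / L i) * sin (k%:R * pi * th' / L i)).
Proof.
rewrite -[LHS]mulrA; congr (_ * _); congr (expR (- _)).
have /lt0r_neq0 J0 := JprodR_gt0 R P i; rewrite /Lgrid.
have := pi_gt0 R; move: (@pi R) => p /lt0r_neq0 p0.
by field; apply/andP.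
Qed.

Lemma kernelD_term_bound i k th th' :
  `|expR (- (k%:R ^+ 2 * pi ^+ 2 * t / L i ^+ 2)) *
    sin (k%:R * pi * th / L i) * sin (k%:R * pi * th' / L i)| <=
  expR (- (k%:R ^+ 2 * (J i)%:R ^+ 2 * t)).
Proof.
rewrite kernelD_termE normrM (ger0_norm (expR_ge0 _)) ler_piMr ?expR_ge0 //.
by rewrite normrM mulr_ile1 ?sin_max.
Qed.

Lemma Jprod_sqr_ge1 i : 1 <= (J i)%:R ^+ 2 :> R.
Proof. by rewrite exprn_ege1 // ler1n Jprod_gt0. Qed.

Lemma kernelD_bound i th th' :
  `|kernelD P i t th th'| <=
  2 / L i * (expR (t - (J i)%:R ^+ 2 * t) / (1 - q)).
Proof.
rewrite /kernelD normrM ger0_norm; last by rewrite divr_ge0 // ltW // Lgrid_gt0.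
rewrite ler_wpM2l //; first by rewrite divr_ge0 // ltW // Lgrid_gt0.
have step := geometric_series_step (Jprod_sqr_ge1 i)
  (fun k _ => kernelD_term_bound i k th th').
(* The tail at index 0 is the whole series, the partial sum there being empty. *)
have := @geometric_step_tail R _ q q0 q1 _ 0%N step.
by rewrite big_geq // subr0 expr0 mulr1.
Qed.

Lemma continuous_kernelD i th : continuous (kernelD P i t th : R -> R).
Proof.
have step n th' := geometric_series_step (Jprod_sqr_ge1 i)
  (fun k _ => kernelD_term_bound i k th th') n.
move=> x; apply: cvgMl_tmp.
move: x; apply: (geometric_step_continuous q0 q1 step) => n.
apply: continuous_sum_nat => k x; apply: cvgMl_tmp.
apply: continuous_comp; last exact: continuous_sin.
by apply: cvgMr_tmp; apply: cvgMl_tmp; exact: cvg_id.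
Qed.

End Series.

End Kernels.

(** * Continuity and increments of the kernels on [F i] *)

Section KernelF.
Context (R : realType) (P : diamond_params) (t : R) (t0 : 0 < t).

Local Notation F := (Fspace R P).
Local Notation J := (Jprod P).
Local Notation N := (Nprod P).
Local Notation L := (Lgrid R P).
Local Notation q := (expR (- t)).

Let q0 : 0 <= q. Proof. exact: expR_ge0. Qed.
Let q1 : q < 1. Proof. by rewrite expR_lt1 oppr_lt0. Qed.

Lemma cos_period (a : R) (m : int) : cos (a + 2 * pi * m%:~R) = cos a.
Proof.
have natp b n : cos (b + 2 * pi * n%:R) = cos b :> R.
  by rewrite (mulr_natl pi 2) mulr_natr (periodicn (@cosD2pi R)).
case: m => n; first by rewrite -pmulrn natp.
by rewrite NegzE rmorphN /= -pmulrn -[LHS](natp _ n.+1) mulrN subrK.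
Qed.

(** [circle_angle] jumps by [2 * pi], but cosines of integer frequency do not see full turns, so the
    angle may be replaced by the real parameter [eta]. *)
Lemma continuous_kernelF0 x : continuous (kernelF0 t x : F 0 -> R).
Proof.
apply: continuous_from_Fpt => w.
pose g (eta : R) := 1 / (2 * pi) + 1 / pi * limn (fun n => \sum_(1 <= k < n)
  (expR (- (k%:R ^+ 2 * t)) * cos (k%:R * (eta - circle_angle x)))).
rewrite (_ : (fun eta => _) = g); last first.
  apply/funext => eta; rewrite /g /kernelF0.
  have [k hk] := level_angle_Fpt eta w; rewrite /= in hk; rewrite hk.
  congr (_ + _ * _); congr (limn _).
  apply/funext => n; apply: eq_bigr => l _; congr (_ * _).
  rewrite -[RHS](cos_period _ (l%:Z * k)) rmorphM /= -pmulrn; congr cos; ring.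
move=> x'; apply: cvgD; first exact: cvg_cst.
apply: cvgMl_tmp; move: x'.
apply: (@geometric_step_continuous _ (expR (t - 1 * t)) q q0 q1).
  move=> n eta; apply: (geometric_series_step t0 (lexx 1)) => k _.
  by rewrite mulr1 normrM (ger0_norm (expR_ge0 _)) ler_piMr ?expR_ge0 // cos_max.
move=> n; apply: continuous_sum_nat => k eta; apply: cvgMl_tmp.
apply: continuous_comp; last exact: continuous_cos.
by apply: cvgMl_tmp; apply: cvgB; [exact: cvg_id|exact: cvg_cst].
Qed.

(* On ](m-1)L, (m+1)L[ the correction is a sum of two Dirichlet kernels, one for
   each of the two adjacent cells, each of them extended by 0 across mL. *)
Lemma continuous_kernel_correction i (ax : addr P i.+1) thx :
  continuous (fun y : F i.+1 => addr_coef R ax (cell_coord y).2 *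
                               kernelD P i.+1 t thx (cell_coord y).1).
Proof.
apply: continuous_from_Fpt => w eta0.
have L0 := Lgrid_gt0 R P i.+1.
pose m := Num.floor (eta0 / L i.+1).
have /andP[h1 h2] := floor_itv (eta0 / L i.+1); rewrite -/m in h1 h2.
rewrite ler_pdivlMr // in h1; rewrite ltr_pdivrMr // intrD mulrDl mul1r in h2.
have [a ha] := grid_addr R m w; have [b hb] := grid_addr R (m - 1) w.
set M := m%:~R * L i.+1 in h1 h2.
have M1 : (m - 1)%:~R * L i.+1 = M - L i.+1 by rewrite rmorphB /= mulrBl mul1r.
(* Clamping at [M] realises the extension by 0: a clamped angle sits at the right end of the left
   cell or at the left end of the right cell. *)
pose g (eta : R) :=
  addr_coef R ax b * kernelD P i.+1 t thx (Num.min eta M - (M - L i.+1)) +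
  addr_coef R ax a * kernelD P i.+1 t thx (Num.max eta M - M).
have cg : continuous g.
  move=> x; apply: cvgD; apply: cvgMl_tmp;
    apply: (@continuous_comp _ _ _ (fun e : R => _ - _));
    try exact: continuous_kernelD;
    apply: cvgB; try exact: cvg_cst.
    exact: (@continuous_min _ _ (fun e : R => e) (fun=> M) _ cvg_id (cvg_cst _)).
  exact: (@continuous_max _ _ (fun e : R => e) (fun=> M) _ cvg_id (cvg_cst _)).
have gE eta : M - L i.+1 < eta < M + L i.+1 -> g eta =
    addr_coef R ax (cell_coord (Fpt eta w)).2 *
    kernelD P i.+1 t thx (cell_coord (Fpt eta w)).1.
  move=> /andP[e1 e2]; rewrite /g; have [eM|Me] := leP eta M.
    rewrite subrr kernelD_th2_0 mulr0 addr0 -M1.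
    rewrite (addr_coef_kernelD _ _ _ (m := m - 1) (a := b)) //.
    by rewrite subrK M1 eM ltW.
  have -> : M - (M - L i.+1) = L i.+1 by ring.
  rewrite kernelD_th2_L mulr0 add0r.
  rewrite (addr_coef_kernelD _ _ _ (m := m) (a := a)) //.
  by rewrite ltW //= intrD mulrDl mul1r ltW.
have e0 : M - L i.+1 < eta0 < M + L i.+1 by apply/andP; split; lra.
have := cg eta0; rewrite /continuous_at gE //; apply: cvg_trans; apply: near_eq_cvg.
near=> eta; apply: gE; apply/andP; split; near: eta.
  by apply: lt_nbhsr; case/andP: e0.
by apply: lt_nbhsl; case/andP: e0.
Unshelve. all: by end_near. Qed.

Lemma continuous_kernelF i (x : F i) : continuous (kernelF t x).
Proof.
elim: i x => [|i IH] x; first exact: continuous_kernelF0.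
have c1 : continuous (fun y : F i.+1 => kernelF t (Fproj x) (Fproj y)).
  move=> y; apply: (@continuous_comp _ _ _ (@Fproj R P i) (kernelF t (Fproj x))).
    exact: continuous_Fproj.
  exact: IH.
have c2 := @continuous_kernel_correction i (cell_coord x).2 (cell_coord x).1.
have c3 y := cvgD (c1 y) (@cvgMl_tmp _ _ _ _ _ (N i)%:R _ (c2 y)).
rewrite (_ : kernelF t x = (fun y : F i.+1 => kernelF t (Fproj x) (Fproj y) +
  (N i)%:R * (addr_coef R (cell_coord x).2 (cell_coord y).2 *
     kernelD P i.+1 t (cell_coord x).1 (cell_coord y).1))).
  by move=> y; exact: c3.
by apply/funext => y; rewrite mulrA [X in _ + X * _]mulrC.
Qed.

(** The coefficient is at most [npar P i.+1], which turns [N i] into [N i.+1]; the factor [J i.+1]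
    comes from [2 / L i.+1], and [1 - q] from summing the geometric series. *)
Lemma kernelF_step i (x y : F i.+1) :
  `|kernelF t x y - kernelF t (Fproj x) (Fproj y)| <=
  (2 * expR t / (pi * (1 - q))) *
    ((N i.+1)%:R * (J i.+1)%:R * expR (- ((J i.+1)%:R ^+ 2 * t))).
Proof.
rewrite [kernelF t x y]/= addrAC subrr add0r 2!normrM (ger0_norm (ler0n R _)).
have cb : `|bundle_coef x y| * (N i)%:R <= (npar P i.+1)%:R * (N i)%:R.
  by apply: ler_wpM2r; [exact: ler0n|exact: addr_coef_bound].
have kb := kernelD_bound P t0 i.+1 (cell_coord x).1 (cell_coord y).1.
apply: le_trans (ler_pM _ _ cb kb) _ => //.
have q1' : 1 - q != 0 by rewrite subr_eq0 gt_eqF.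
have := pi_gt0 R; rewrite /Lgrid; move: (@pi R) => p /lt0r_neq0 p0.
have /lt0r_neq0 J0 := JprodR_gt0 R P i.+1.
rewrite expRD Nprod_succ natrM le_eqVlt; apply/orP; left; apply/eqP.
by field; rewrite q1' J0 p0.
Qed.

End KernelF.

(** * The inverse limit *)

Section DiamondFractal.
Context (R : realType) (P : diamond_params).

Local Notation F := (Fspace R P).
Local Notation X := (Finf R P).

Lemma Phi_inj (x y : X) : (forall i, Phi i x = Phi i y) -> x = y.
Proof.
move=> h; apply: val_inj => /=.
by apply: functional_extensionality_dep => i; exact: h.
Qed.

Lemma Fproj_Phi i (x : X) : Fproj (Phi i.+1 x) = Phi i x.
Proof. exact: (set_mem (valP x) i). Qed.

Lemma Phi_eq_le i j (x y : X) : (i <= j)%N -> Phi j x = Phi j y -> Phi i x = Phi i y.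
Proof.
move=> /subnKC <-; elim: (j - i)%N => [|k IH]; first by rewrite addn0.
by rewrite addnS => h; apply: IH; rewrite -(Fproj_Phi _ x) -(Fproj_Phi _ y) h.
Qed.

(** The topology is induced from the product, so convergence is coordinatewise. The filter is
    arbitrary because points and levels will vary jointly. *)
Lemma cvg_Finf (T : Type) (G : set_system T) (z : T -> X) (x : X) : Filter G ->
  (forall i, Phi i (z u) @[u --> G] --> Phi i x) -> z @ G --> x.
Proof.
move=> FG h U [_ /= [[B oB <-] Bx] sU].
have : (fun u => set_val (z u) : prod_topology (fun i => F i)) @ G --> set_val x.
  apply/cvg_sup => i A [_ /= [[C oC <-] Cx] sA].
  apply: (@filterS _ _ _ ((fun u => Phi i (z u)) @^-1` C)).
    by move=> u; exact: sA.
  by apply: h; exact: open_nbhs_nbhs.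
move=> /(_ B) hB; apply: (@filterS _ _ _ ((fun u => set_val (z u)) @^-1` B)).
  by move=> u; exact: sU.
by apply: hB; exact: open_nbhs_nbhs.
Qed.

Lemma continuous_Phi i : continuous (@Phi R P i).
Proof.
move=> x; apply: (@continuous_comp _ _ _ (set_val : X -> _)
  (fun f : prod_topology (fun i => F i) => f i)).
  exact: initial_continuous.
exact: (@proj_continuous _ (fun i => F i)).
Qed.

Lemma continuous_Finf (Y : topologicalType) (h : Y -> X) :
  (forall i, continuous (Phi i \o h)) -> continuous h.
Proof. by move=> ch y; apply: cvg_Finf => i; exact: ch. Qed.

(** * Infinite addresses and compactness *)

Local Notation branches := (prod_topology (branch P)).

(** Letters start at level 1: the entry [om 0], in a one-point space, is never read. *)
Fixpoint trunc (om : branches) i : word P i :=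
  match i return word P i with
  | 0 => tt
  | i'.+1 => (trunc om i', om i'.+1)
  end.

Lemma trunc_compatible (eta : R) (om : branches) :
  compatible (fun i => Fpt eta (trunc om i) : F i).
Proof. by move=> i; rewrite Fproj_Fpt. Qed.

Definition Finf_pt (eta : R) (om : branches) : X :=
  exist _ ((fun i => Fpt eta (trunc om i)) : prod_topology (fun i => F i))
    (mem_set (trunc_compatible eta om)).

Lemma Phi_Finf_pt i eta om : Phi i (Finf_pt eta om) = Fpt eta (trunc om i).
Proof. by []. Qed.

Lemma continuous_Finf_pt :
  continuous (fun p : R * branches => Finf_pt p.1 p.2).
Proof.
apply: continuous_Finf => i.
elim: i => [|i IH] x.
  apply: (@continuous_comp _ _ _ fst (fun eta : R => Fpt eta (tt : word P 0))).
    exact: cvg_fst.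
  exact: continuous_Fpt.
have IH' : Fpt p.1 (trunc p.2 i) @[p --> x] --> (Fpt x.1 (trunc x.2 i) : F i).
  exact: IH.
have cb : (p.2 i.+1 : branch P i.+1) @[p --> x] --> (x.2 i.+1 : branch P i.+1).
  apply: (@continuous_comp _ _ _ snd (fun om : branches => om i.+1)).
    exact: cvg_snd.
  exact: (@proj_continuous _ (branch P)).
apply: (@continuous_comp _ _ _
  (fun p : R * branches => (Fpt p.1 (trunc p.2 i) : F i, p.2 i.+1 : branch P i.+1))
  (@Fglue R P i)).
  exact: (cvg_pair IH' cb).
exact: continuous_Fglue.
Qed.

Lemma Finf_pt_surj (x : X) : exists (eta : R) (om : branches),
  0 <= eta <= 2 * pi /\ Finf_pt eta om = x.
Proof.
have hb k : exists b : branch P k.+1, Fglue (Phi k x, b) = Phi k.+1 x.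
  (* A representative of the point at level [k.+1] projects to [Phi k x], so only its letter is
     new. *)
  have [[y b] e] := FglueK (Phi k.+1 x); exists b.
  by rewrite -e -Fproj_Phi -e Fproj_Fglue.
pose om l : branch P l := match l return branch P l with
  | 0 => point | k.+1 => sval (cid (hb k)) end.
have [/andP[h1 h2] h3] := circle_angleP (Phi 0 x : circle R).
exists (circle_angle (Phi 0 x : circle R)), om; split.
  by rewrite h1 ltW.
apply: Phi_inj; elim=> [//|k IH].
by rewrite Phi_Finf_pt Fpt_succ /= -Phi_Finf_pt IH; exact: (svalP (cid (hb k))).
Qed.

(** By Tychonoff, [[0, 2 * pi]] times the product of the finite branch sets is compact, and
    [Finf_pt] maps it continuously onto the space. *)
Lemma compact_Finf : compact [set: X].
Proof.
have cK : compact (`[0 : R, 2 * pi]%classic `*` [set: branches]).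
  apply: compact_setX; first exact: segment_compact.
  have := @tychonoff _ (branch P) (fun=> setT).
  rewrite (_ : [set f | _] = [set: branches]); last by apply/seteqP; split.
  by apply => l; apply: finite_compact; exact: finite_finset.
have -> : [set: X] = (fun p : R * branches => Finf_pt p.1 p.2) @`
    (`[0 : R, 2 * pi]%classic `*` [set: branches]).
  apply/seteqP; split => // x _; have [eta [om [h <-]]] := Finf_pt_surj x.
  by exists (eta, om) => //; split => //=; rewrite in_itv.
apply: continuous_compact => //; apply: continuous_subspaceT.
exact: continuous_Finf_pt.
Qed.

(** Fibres of [Phi i] shrink as [i] grows, uniformly by compactness. *)
Lemma continuous_Finf_oscillation (f : X -> R) (e : R) : continuous f -> 0 < e ->
  \forall i \near \oo, forall x y, Phi i x = Phi i y -> `|f x - f y| < e.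
Proof.
move=> cf e0.
pose bad (p : X * nat) z := Phi p.2 z = Phi p.2 p.1 /\ e <= `|f z - f p.1|.
(* [z p] is a point of the same fibre violating the bound if there is one, and the base point
   otherwise; a good value at [z p] thus controls the whole fibre. *)
pose z p := if pselect (exists z, bad p z) is left h then sval (cid h) else p.1.
have zE p : Phi p.2 (z p) = Phi p.2 p.1.
  by rewrite /z; case: pselect => // h; have [] := svalP (cid h).
have zP p : `|f (z p) - f p.1| < e ->
    forall y, Phi p.2 y = Phi p.2 p.1 -> `|f y - f p.1| < e.
  rewrite /z; case: pselect => [h|h _ y hy].
    by have [_ +] := svalP (cid h) => /le_lt_trans/[apply]; rewrite ltxx.
  by rewrite ltNge; apply/negP => hy'; apply: h; exists y.
have /compact_near_coveringP cov := compact_Finf.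
have {cov} := cov nat \oo
  (fun i y => forall x, Phi i x = Phi i y -> `|f x - f y| < e) _.
have cover x : [set: X] x -> \forall x' \near x & i \near \oo,
    forall y, Phi i y = Phi i x' -> `|f y - f x'| < e.
  move=> _; pose G := filter_prod (nbhs x) (\oo : set_system nat).
  have c1 : fst @ G --> x by exact: cvg_fst.
  have cz : z @ G --> x.
    apply: cvg_Finf => k.
    have ck : Phi k p.1 @[p --> G] --> Phi k x.
      exact: (cvg_comp _ _ c1 (@continuous_Phi k x)).
    (* Once the level reaches [k], [z p] and [p.1] have the same coordinate [k]. *)
    apply: cvg_trans ck; apply: near_eq_cvg.
    have : \forall p \near G, (k <= p.2)%N.
      exists (setT, [set i | (k <= i)%N]) => /=.
        by split; [exact: filterT|exact: nbhs_infty_ge].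
      by move=> [y i] /= [].
    by apply: filterS => p kp; apply: (Phi_eq_le kp).
  have cd : (f (z p) - f p.1) @[p --> G] --> f x - f x.
    apply: cvgB; first exact: (cvg_comp _ _ cz (cf x)).
    exact: (cvg_comp _ _ c1 (cf x)).
  have : \forall p \near G, `|f (z p) - f p.1| < e.
    move/cvgrPdist_lt : cd => /(_ e e0); apply: filterS => p.
    by rewrite subrr sub0r normrN.
  by apply: filterS => p; exact: zP.
move=> /(_ _ cover); apply: filterS => i h x y hxy; exact: (h y _ x).
Qed.

(** Continues a word by the first branch at all later levels. *)
Fixpoint extend i : word P i -> branches :=
  match i return word P i -> branches with
  | 0 => fun=> fun l => point
  | i'.+1 => fun w => dfwith (extend w.1) i'.+1 w.2
  end.

Lemma extend_out i (w : word P i) l : (i < l)%N -> extend w l = point.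
Proof.
elim: i w => [//|i IH] w il; rewrite [extend w]/= dfwithout ?IH //; first exact: ltnW.
by rewrite neq_ltn il.
Qed.

Lemma eq_trunc om om' i : (forall l, (l <= i)%N -> om l = om' l) ->
  trunc om i = trunc om' i.
Proof.
elim: i => [//|i IH] h /=; rewrite IH ?h // => l li; apply: h; exact: leqW.
Qed.

Lemma trunc_extend i (w : word P i) : trunc (extend w) i = w.
Proof.
elim: i w => [[]//|i IH] w; rewrite [trunc _ _]/= dfwithin.
rewrite (@eq_trunc _ (extend w.1)) ?IH; first by case: w.
by move=> l li; rewrite dfwithout // neq_ltn orbC ltnS li.
Qed.

(** Beyond level [i] both sequences take the same letters, so an identification at level [i]
    persists upwards. Hence [Fsection] does not depend on the representative chosen. *)
Lemma Finf_pt_extend_eq i (eta eta' : R) (w w' : word P i) :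
  Fpt eta w = Fpt eta' w' -> Finf_pt eta (extend w) = Finf_pt eta' (extend w').
Proof.
move=> h; have hi : Phi i (Finf_pt eta (extend w)) = Phi i (Finf_pt eta' (extend w')).
  by rewrite !Phi_Finf_pt !trunc_extend.
apply: Phi_inj => k; have [ki|ik] := leqP k i; first exact: Phi_eq_le hi.
rewrite -(subnKC (ltnW ik)); elim: (k - i)%N => [|d IH]; first by rewrite addn0.
rewrite addnS !Phi_Finf_pt !Fpt_succ /= -!Phi_Finf_pt IH.
by rewrite !extend_out // ltnS leq_addr.
Qed.

Definition Fsection i (x : F i) : X :=
  let h := cid (Fpt_surj x) in Finf_pt (sval h) (extend (sval (cid (svalP h)))).

Lemma Fsection_Fpt i (eta : R) (w : word P i) :
  Fsection (Fpt eta w) = Finf_pt eta (extend w).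
Proof.
apply: Finf_pt_extend_eq.
exact: (svalP (cid (svalP (cid (Fpt_surj (Fpt eta w)))))).
Qed.

Lemma FsectionK i (x : F i) : Phi i (Fsection x) = x.
Proof.
by have [eta [w <-]] := Fpt_surj x; rewrite Fsection_Fpt Phi_Finf_pt trunc_extend.
Qed.

Lemma continuous_Fsection i : continuous (@Fsection i).
Proof.
apply: continuous_from_Fpt => w; under eq_fun do rewrite Fsection_Fpt.
by apply: continuous_Finf => k; exact: continuous_Fpt.
Qed.

End DiamondFractal.

(** * The limit heat kernel *)

Section HeatKernel.
Context (R : realType) (P : diamond_params).

Local Notation F := (Fspace R P).
Local Notation J := (Jprod P).
Local Notation N := (Nprod P).
Local Notation X := (Finf R P).

(** * Integration against the limit measure *)

Section Measures.
Context (mu : {measure set (borel X) -> \bar R}) (hmu : limit_measure mu).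

Lemma limit_measure_fin : (mu [set: borel X] < +oo)%E.
Proof.
have := @hmu 0%N setT (@measurableT _ _); rewrite preimage_setT => ->.
rewrite /Fmeasure preimage_setT setIT lebesgue_measure_itv /=.
by case: ifP => _; rewrite ?ltry // -EFinB ltry.
Qed.

Lemma continuous_integrable (g : X -> R) : continuous g ->
  mu.-integrable [set: borel X] (EFin \o g).
Proof.
move=> cg; apply: measurable_bounded_integrable => //.
- exact: limit_measure_fin.
- exact: continuous_measurable_real.
- have [M hM] := continuous_norm_bounded (@compact_Finf R P) cg.
  exists M; split; first exact: num_real.
  by move=> M' MM' y _; apply: le_trans (hM y) (ltW MM').
Qed.

(** The measure on [F i] is the image of [mu] under [Phi i], so this is a change of variables. *)
Lemma Rintegral_Phi i (g : F i -> R) : continuous g ->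
  \int[@Fmeasure R P i]_y g y = \int[mu]_x g (Phi i x).
Proof.
move=> cg; congr fine.
have mPhi := continuous_borel (@continuous_Phi R P i).
rewrite (@eq_measure_integral _ _ _ setT
  (measure_function_pushforward__canonical__measure_function_Measure mu mPhi)).
  rewrite integral_pushforward //.
    by apply/measurable_EFinP; exact: continuous_measurable_real.
  apply: (@continuous_integrable (fun x => g (Phi i x))) => x.
  apply: (@continuous_comp _ _ _ (@Phi R P i) g); first exact: continuous_Phi.
  exact: cg.
by move=> A mA _; rewrite /= /pushforward hmu.
Qed.

Lemma cvg_Rintegral_uniform (g_ : nat -> X -> R) (g : X -> R) :
  (forall n, continuous (g_ n)) -> continuous g ->
  (forall e, 0 < e -> \forall n \near \oo, forall y, `|g_ n y - g y| <= e) ->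
  \int[mu]_y g_ n y @[n --> \oo] --> \int[mu]_y g y.
Proof.
move=> cgn cg h; pose m := fine (mu [set: borel X]).
have m0 : 0 <= m by exact/fine_ge0/measure_ge0.
apply/cvgrPdist_le => e e0.
(* Adding 1 to the total mass keeps the divisor positive. *)
have e1 : 0 < e / (m + 1) by rewrite divr_gt0 // ltr_wpDl.
apply: filterS (h _ e1) => n hn; rewrite distrC.
rewrite -RintegralB //; try exact: continuous_integrable.
have cd : continuous (fun y => g_ n y - g y).
  by move=> y; exact: (cvgB (cgn n y) (cg y)).
have cnd : continuous (fun y => `|g_ n y - g y|).
  by move=> y; exact: (cvg_norm (cd y)).
apply: le_trans (le_normr_Rintegral _ _) _ => //; first exact: (continuous_integrable cd).
apply: (@le_trans _ _ (\int[mu]_(y in setT) (e / (m + 1)))).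
  apply: le_Rintegral => //; first exact: (continuous_integrable cnd).
  exact: (continuous_integrable (@cst_continuous X R (e / (m + 1)))).
rewrite Rintegral_cst // -/m mulrAC ler_pdivrMr; last by rewrite ltr_wpDl.
by rewrite ler_wpM2l ?lerDl // ltW.
Qed.

End Measures.

Lemma markov_semigroup_uniform (T : R -> (X -> R) -> X -> R) t
    (f_ : nat -> X -> R) (f : X -> R) x :
  markov_semigroup T -> 0 <= t ->
  (forall n, continuous (f_ n)) -> continuous f ->
  (forall e, 0 < e -> \forall n \near \oo, forall y, `|f_ n y - f y| <= e) ->
  T t (f_ n) x @[n --> \oo] --> T t f x.
Proof.
move=> mT t0 cfn cf h; apply/cvgrPdist_le => e e0.
apply: filterS (h _ e0) => n hn.
(* The difference is put in the form [a * f + g] of [ms_linear]; contractivity then bounds it. *)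
pose d y := -1 * f y + f_ n y.
have cd : continuous d.
  by move=> y; exact: (cvgD (@cvgMl_tmp _ _ _ _ _ (-1) _ (cf y)) (cfn n y)).
rewrite distrC.
have -> : T t (f_ n) x - T t f x = T t d x.
  by rewrite (ms_linear mT) // mulN1r addrC.
apply: le_trans (le_supnorm (@compact_Finf R P) x (ms_continuous mT t0 cd)) _.
apply: le_trans (ms_contractive mT t0 cd) _.
by apply: supnorm_le => [|y]; [exact: ltW|rewrite /d mulN1r addrC].
Qed.

Lemma bundle_coef_eq0 i (x y : X) : ~ bundle_levels x y i.+1 ->
  bundle_coef (Phi i.+1 x) (Phi i.+1 y) = 0.
Proof.
move=> h; rewrite /bundle_coef; case: ifP => // /negbFE sb; case: h.
(* The addresses chosen by [cell_coord] are among the closed cells over which [bundle_levels]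
   quantifies. *)
have inc z : cell (cell_coord (Phi i.+1 z)).2 (Phi i.+1 z).
  have [/andP[h1 h2] h3] := cell_coordP (Phi i.+1 z).
  by exists (cell_coord (Phi i.+1 z)).1 => //=; rewrite in_itv /= h1 ltW.
by exists i; split => //; exists (cell_coord (Phi i.+1 x)).2,
  (cell_coord (Phi i.+1 y)).2; split.
Qed.

Lemma kernelF_istar t (x y : X) n : finite_set (bundle_levels x y) ->
  (istar x y <= n)%N ->
  kernelF t (Phi n x) (Phi n y) = kernelF t (Phi (istar x y) x) (Phi (istar x y) y).
Proof.
move=> fin /subnKC <-; elim: (n - _)%N => [|k IH]; first by rewrite addn0.
rewrite addnS [LHS]/= !Fproj_Phi IH bundle_coef_eq0 ?mul0r ?addr0 // => h.
have : (istar x y + k).+1 \in fset_set (bundle_levels x y).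
  by rewrite in_fset_set //; exact: mem_set.
by move=> /(@leq_bigmax_seq _ _ predT id) /(_ isT); rewrite ltnNge leq_addr.
Qed.

(** In the finite case the sequence is constant from [istar] on, so one limit formula covers both
    cases. *)
Lemma kernelFinfE t (x y : X) :
  kernelFinf t x y = limn (fun n => kernelF t (Phi n x) (Phi n y)).
Proof.
rewrite /kernelFinf; case: asboolP => // fin; apply/esym/lim_near_cst => //.
by exists (istar x y) => // n; exact: kernelF_istar.
Qed.

Context (hP : exists2 eps : R, 0 < eps & forall t : R, 0 < t < eps ->
     cvgn (fun i => (N i)%:R * expR (- ((J i)%:R ^+ 2 * t)) : R)).

Lemma geometric_decay (t : R) : 0 < t -> exists2 K, 0 <= K & forall i,
  (N i)%:R * (J i)%:R * expR (- ((J i)%:R ^+ 2 * t)) <= K * 2^-1 ^+ i.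
Proof.
move=> t0; have [eps eps0 heps] := hP.
(* [s] lies below [eps], where the hypothesis bounds [N] times the exponential, and leaves [t / 2]
   of the time to absorb the factor [J]. *)
pose s := Num.min t eps / 2.
have m0 : 0 < Num.min t eps by rewrite lt_min t0.
have s0 : 0 < s by rewrite divr_gt0.
have [mt me] : Num.min t eps <= t /\ Num.min t eps <= eps.
  by rewrite !ge_min !lexx orbT.
have st : s + t / 2 <= t by rewrite /s; lra.
have seps : s < eps by rewrite /s; lra.
have /cvg_seq_bounded[M [_ hM]] := heps s (introT andP (conj s0 seps)).
have hC i : (N i)%:R * expR (- ((J i)%:R ^+ 2 * s)) <= `|M| + 1.
  apply: le_trans (ler_norm _) (hM _ _ _ _) => //.
  by rewrite ltr_pwDr // ler_norm.
exists ((`|M| + 1) * (2 / t)); first by rewrite mulr_ge0 ?divr_ge0 // ltW.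
move=> i; have J0 := JprodR_gt0 R P i.
have e1 : expR (- ((J i)%:R ^+ 2 * t)) <=
    expR (- ((J i)%:R ^+ 2 * s)) * expR (- ((J i)%:R ^+ 2 * (t / 2))).
  rewrite -expRD ler_expR -opprD lerN2 -mulrDr ler_wpM2l // exprn_ge0 // ltW.
have e2 : (J i)%:R * expR (- ((J i)%:R ^+ 2 * (t / 2))) <= 2 / t * 2^-1 ^+ i.
  have JJ : 0 < (J i)%:R ^+ 2 * (t / 2) by rewrite mulr_gt0 ?exprn_gt0 ?divr_gt0.
  (* With [1 + x <= expR x], the exponential is at most [1 / x]; the square of [J i] then leaves a
     factor [1 / J i]. *)
  have h1 : expR (- ((J i)%:R ^+ 2 * (t / 2))) <= ((J i)%:R ^+ 2 * (t / 2))^-1.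
    rewrite expRN lef_pV2 ?posrE ?expR_gt0 //.
    by apply: le_trans (expR_ge1Dx _); rewrite lerDr.
  apply: le_trans (ler_wpM2l (ltW J0) h1) _.
  have -> : (J i)%:R * ((J i)%:R ^+ 2 * (t / 2))^-1 = 2 / t * ((J i)%:R)^-1.
    by field; rewrite !lt0r_neq0.
  apply: ler_wpM2l; first by rewrite divr_ge0 // ltW.
  rewrite exprVn lef_pV2 ?posrE ?exprn_gt0 //.
  by rewrite -natrX ler_nat Jprod_exp2.
have NJ : 0 <= (N i)%:R * (J i)%:R :> R by rewrite mulr_ge0.
apply: le_trans (ler_wpM2l NJ e1) _.
by rewrite mulrACA -[leRHS]mulrA; apply: ler_pM => //; rewrite mulr_ge0 // expR_ge0.
Qed.

Lemma kernelF_Phi_geometric (t : R) : 0 < t -> exists K, forall n (x y : X),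
  `|kernelF t (Phi n.+1 x) (Phi n.+1 y) - kernelF t (Phi n x) (Phi n y)| <=
  K * 2^-1 ^+ n.
Proof.
move=> t0; have [K K0 hK] := geometric_decay t0.
pose C : R := 2 * expR t / (pi * (1 - expR (- t))).
have C0 : 0 <= C.
  rewrite divr_ge0 ?mulr_ge0 ?expR_ge0 ?pi_ge0 //.
  by rewrite subr_ge0 expR_le1 oppr_le0 ltW.
exists (C * K) => n x y; rewrite -(Fproj_Phi n x) -(Fproj_Phi n y).
apply: le_trans (kernelF_step t0 _ _) _; rewrite -/C -[leRHS]mulrA.
apply: ler_wpM2l => //; apply: le_trans (hK _) _.
(* The decay holds at level [n.+1]; one factor [2^-1] is dropped to index it by [n]. *)
rewrite ler_wpM2l // exprS ler_piMl ?exprn_ge0 //.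
by rewrite invf_le1 // ler1n.
Qed.

Lemma kernelF_Phi_cvg (t : R) (x y : X) : 0 < t ->
  cvgn (fun n => kernelF t (Phi n x) (Phi n y)).
Proof.
move=> /kernelF_Phi_geometric[K hK].
apply: (@geometric_step_cvg _ K 2^-1) => [//||n]; last exact: hK.
by rewrite invf_lt1 // ltr1n.
Qed.

Lemma continuous_kernelF_Phi (t : R) (x : X) n : 0 < t ->
  continuous (fun y : X => kernelF t (Phi n x) (Phi n y)).
Proof.
move=> t0 y; apply: (@continuous_comp _ _ _ (@Phi R P n) (kernelF t (Phi n x))).
  exact: continuous_Phi.
exact: continuous_kernelF.
Qed.

Lemma continuous_kernelFinf (t : R) (x : X) : 0 < t ->
  continuous (kernelFinf t x : X -> R).
Proof.
move=> t0; have [K hK] := kernelF_Phi_geometric t0.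
have -> : kernelFinf t x = fun y => limn (fun n => kernelF t (Phi n x) (Phi n y)).
  by apply/funext => y; exact: kernelFinfE.
apply: (@geometric_step_continuous _ K 2^-1) => [//|||n].
- by rewrite invf_lt1 // ltr1n.
- by move=> n y; exact: hK.
- exact: continuous_kernelF_Phi.
Qed.

Lemma kernelF_Phi_uniform (t : R) (x : X) (e : R) : 0 < t -> 0 < e ->
  \forall n \near \oo, forall y : X,
    `|kernelF t (Phi n x) (Phi n y) - kernelFinf t x y| <= e.
Proof.
move=> t0 e0; have [K hK] := kernelF_Phi_geometric t0.
have h0 : 0 <= 2^-1 :> R by [].
have h1 : 2^-1 < 1 :> R by rewrite invf_lt1 // ltr1n.
have /cvgrPdist_le/(_ e e0) := cvg_geometric_tail K h0 h1.
apply: filterS => n; rewrite sub0r normrN => hn y.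
rewrite distrC kernelFinfE; apply: le_trans (le_trans (ler_norm _) hn).
by apply: geometric_step_tail => // k; exact: hK.
Qed.

Lemma is_heat_kernel_kernelFinf (mu : {measure set (borel X) -> \bar R})
    (T : R -> (X -> R) -> X -> R) :
  limit_measure mu -> diffusion_semigroup T -> is_heat_kernel mu T (@kernelFinf R P).
Proof.
move=> hmu [mT hT] t f x t0 cf.
have ck := @continuous_kernelFinf t x t0.
have ckf : continuous (fun y => kernelFinf t x y * f y).
  by move=> y; exact: (cvgM (ck y) (cf y)).
split; first exact: (continuous_integrable hmu ckf).
pose f_ n := f \o @Fsection R P n \o @Phi R P n.
have cs n : continuous (f \o @Fsection R P n).
  by move=> y; exact: (continuous_comp (@continuous_Fsection R P n y) (cf _)).
have cfn n : continuous (f_ n).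
  by move=> y; exact: (continuous_comp (@continuous_Phi R P n y) (cs n _)).
have uf (e : R) : 0 < e -> \forall n \near \oo, forall y, `|f_ n y - f y| <= e.
  move=> e0; apply: filterS (continuous_Finf_oscillation cf e0) => n hn y.
  by apply/ltW/hn; rewrite FsectionK.
(* [f_ n] factors through [Phi n], so the semigroup of [F n] computes the left side and
   [Rintegral_Phi] transports the integral. *)
have TE n : T t (f_ n) x = \int[mu]_y (kernelF t (Phi n x) (Phi n y) * f_ n y).
  rewrite hT ?ltW //= /semigroupF gt_eqF //.
  apply: (Rintegral_Phi hmu
    (g := fun y => kernelF t (Phi n x) y * (f \o @Fsection R P n) y)).
  by move=> y; exact: (cvgM (@continuous_kernelF R P t t0 n (Phi n x) y) (cs n y)).
have := @markov_semigroup_uniform T t f_ f x mT (ltW t0) cfn cf uf.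
under eq_fun do rewrite TE.
move=> c1; apply: (cvg_unique _ c1) => //.
have [A hA] := continuous_norm_bounded (@compact_Finf R P) cf.
have [B hB] := continuous_norm_bounded (@compact_Finf R P) ck.
have A0 : 0 <= A by exact: le_trans (hA x).
have B0 : 0 <= B by exact: le_trans (hB x).
apply: cvg_Rintegral_uniform => //.
  by move=> n y; exact: (cvgM (@continuous_kernelF_Phi t x n t0 y) (cfn n y)).
(* With [A] bounding [f] and [B] the kernel, [d] makes [d * A + B * d] at most [e]; the added 1
   keeps the divisor positive. *)
move=> e e0; pose d := e / (A + B + 1).
have d0 : 0 < d by rewrite divr_gt0 // ltr_wpDl // addr_ge0.
apply: filterS2 (uf d d0) (@kernelF_Phi_uniform t x d t0 d0) => n h1 h2 y.
have -> : kernelF t (Phi n x) (Phi n y) * f_ n y - kernelFinf t x y * f y =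
  (kernelF t (Phi n x) (Phi n y) - kernelFinf t x y) * f_ n y +
  kernelFinf t x y * (f_ n y - f y) by ring.
apply: le_trans (ler_normD _ _) _; rewrite !normrM.
apply: (@le_trans _ _ (d * A + B * d)).
  (* The values of [f_ n] are values of [f], hence also bounded by [A]. *)
  by apply: lerD; apply: ler_pM => //; exact: hA.
have -> : d * A + B * d = e * ((A + B) / (A + B + 1)) by rewrite /d; ring.
have AB : 0 < A + B + 1 by rewrite ltr_wpDl // addr_ge0.
by apply: ler_piMr; [exact: ltW|rewrite ler_pdivrMr // mul1r lerDl].
Qed.

End HeatKernel.

Theorem theorem3p4 (R : realType) (P : diamond_params)
  (hP : exists2 eps : R, 0 < eps & forall t : R, 0 < t < eps ->
     cvgn (fun i => (Nprod P i)%:R * expR (- ((Jprod P i)%:R ^+ 2 * t)) : R))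
  (mu : {measure set (borel (Finf R P)) -> \bar R}) (hmu : limit_measure mu)
  (T : R -> (Finf R P -> R) -> Finf R P -> R) (hT : diffusion_semigroup T) :
  (forall (t : R) (x y : Finf R P), 0 < t -> infinite_set (bundle_levels x y) ->
     cvgn (fun i => kernelF t (Phi i x) (Phi i y))) /\
  is_heat_kernel mu T (@kernelFinf R P).
Proof.
split; last exact: is_heat_kernel_kernelFinf.
by move=> t x y t0 _; exact: kernelF_Phi_cvg.
Qed.
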